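(* Consider the stochastic shortest path problem described in the context. Assume that there exists a $\delta>0$ such that $$Q^*_\delta(x,u)<\infty\qquad\text{for all } x\in X^*,\ u\in U(x).$$ Then: (a) $\hat J$ is the unique solution $J$, within the set $\widehat{\mathcal W}$, of the Bellman equation $$J(x)=\inf_{u\in U(x)}E\big\{g(x,u,w)+J(f(x,u,w))\big\},\qquad x\in X.$$ (b) If $\{J_k\}$ is the sequence generated by the value iteration algorithm $$J_{k+1}(x)=\inf_{u\in U(x)}E\big\{g(x,u,w)+J_k(f(x,u,w))\big\},\qquad x\in X,\ k=0,1,\ldots,$$ starting with some $J_0\in\widehat{\mathcal W}$, then $J_k\to\hat J$ pointwise. (c) If $\mu$ is a stationary policy that is proper at all $x\in\widehat X$, and for all $x\in X$ we have $$\mu(x)\in\arg\min_{u\in U(x)}E\big\{g(x,u,w)+\hat J(f(x,u,w))\big\},\qquad ( * )$$ then $\mu$ is optimal over the set of proper policies, i.e., $J_\mu=\hat J$. Conversely, if $\mu$ is a stationary policy that is proper at all $x\in\widehat X$ and is optimal within the set of proper policies, i.e., $J_\mu=\hat J$, then $\mu$ satisfies $( * )$ for all $x\in X$.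
   Context: Problem. $X$ (states) and $U$ (controls) are arbitrary sets; $W$ (disturbances) is a countable set. For each $x\in X$ there is a nonempty constraint set $U(x)\subset U$. The system is $x_{k+1}=f(x_k,u_k,w_k)$, $k=0,1,\ldots$, with $f:X\times U\times W\to X$, where $w_k$ has given probability distribution $P(w_k\mid x_k,u_k)$ on $W$. The cost per stage is a function $g$ on $X\times U\times W$ with nonnegative, finite expected value: $0\le E\{g(x,u,w)\}<\infty$ for all $x\in X$, $u\in U(x)$, where $E$ is with respect to $P(w\mid x,u)$. There is a special destination state $t\in X$ that is cost-free and absorbing: $f(t,u,w)=t$ and $g(t,u,w)=0$ for all $u\in U(t)$, $w\in W$. Policies. A policy is a sequence $\pi=\{\mu_0,\mu_1,\ldots\}$ of functions $\mu_k:X\to U$ with $\mu_k(x)\in U(x)$ for all $x$; $\Pi$ is the set of all policies. A policy $\{\mu,\mu,\ldots\}$ is called stationary and denoted by $\mu$. $E^\pi_{x_0}$ is expectation with respect to the probability measure on trajectories induced by initial state $x_0$ and policy $\pi$. The cost function of $\pi$ is $J_\pi(x_0)=\sum_{k=0}^\infty E^\pi_{x_0}\{g(x_k,\mu_k(x_k),w_k)\}\in[0,\infty]$, and $J_\mu$ denotes the cost function of a stationary policy $\mu$. The optimal cost function is $J^*(x)=\inf_{\pi\in\Pi}J_\pi(x)$, and $X^*=\{x\in X\mid J^*(x)<\infty\}$. Proper policies. Let $r_k(\pi,x)$ be the probability that $x_k\ne t$ when using $\pi$ and starting from $x_0=x$. A policy $\pi$ is proper at $x$ if $J_\pi(x)<\infty$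 and $\sum_{k=0}^\infty r_k(\pi,x)<\infty$. $\widehat\Pi_x$ is the set of policies that are proper at $x$; $\mathcal C=\{(\pi,x)\mid \pi\in\widehat\Pi_x\}$; $\hat J(x)=\inf_{\pi\in\widehat\Pi_x}J_\pi(x)$ (with $\inf\emptyset=\infty$); $\widehat X=\{x\in X\mid\hat J(x)<\infty\}$. Perturbed problem. For $\delta>0$, the $\delta$-perturbed problem is the same problem with cost per stage $g(x,u,w)+\delta$ for $x\ne t$, and $g(t,u,w)=0$ unchanged. Its cost functions are $J_{\pi,\delta}(x)=J_\pi(x)+\delta\sum_{k=0}^\infty r_k(\pi,x)$ and its optimal cost function is $\hat J_\delta(x)=\inf_{\pi\in\Pi}J_{\pi,\delta}(x)$. Define $Q^*_\delta(x,u)=E\{g(x,u,w)+\delta+\hat J_\delta(f(x,u,w))\}$. Function sets. $\mathcal J$ is the set of functions $J:X\to[0,\infty]$ with $J(t)=0$, and $$\widehat{\mathcal W}=\Big\{J\in\mathcal J\ \Big|\ \hat J\le J,\ E^\pi_{x_0}\{J(x_k)\}\to0\text{ as }k\to\infty\text{ for all }(\pi,x_0)\in\mathcal C\Big\},$$ where $\{x_k\}$ is the state sequence generated from $x_0$ using $\pi$. All inequalities and limits between functions are pointwise. $\arg\min$ denotes the set of $u\in U(x)$ attaining the infimum (which may equal $\infty$). *)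

(* Defs.v *)
From HB Require Import structures.
From mathcomp Require Import all_boot all_order all_algebra.
From mathcomp Require Import all_classical all_reals all_analysis.

Set Implicit Arguments.
Unset Strict Implicit.
Unset Printing Implicit Defensive.

Import Order.TTheory GRing.Theory Num.Theory.
Import numFieldNormedType.Exports.
Local Open Scope classical_set_scope.
Local Open Scope ring_scope.
Local Open Scope ereal_scope.

(* The countability of [W] and the discreteness of its sigma-algebra are
   required in [stochastic_shortest_path]. The values of the data at controls
   outside [controls x] are irrelevant. *)
Record ssp_data (R : realType) (X U : Type) (d : measure_display)
    (W : measurableType d) := SspData {
  controls : X -> set U ;
  dynamics : X -> U -> W -> X ;
  noise_law : X -> U -> probability W R ;
  stage_cost : X -> U -> W -> R ;
  destination : X }.

Section ssp.
Context {R : realType} {X U : Type} {d : measure_display}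
  {W : measurableType d}.
Implicit Types (S : ssp_data R X U W) (pi : nat -> X -> U) (mu : X -> U)
  (J : X -> \bar R) (x : X) (u : U) (k : nat) (delta : R).

Definition mean_cost S x u : \bar R :=
  \int[noise_law S x u]_w (stage_cost S x u w)%:E.

(* [stage_cost] may take negative values; only its mean is nonnegative. *)
Record stochastic_shortest_path S : Prop := {
  disturbances_countable : countable [set: W] ;
  disturbances_discrete : forall A : set W, measurable A ;
  controls_nonempty : forall x, controls S x !=set0 ;
  stage_cost_integrable : forall x u, controls S x u ->
    (noise_law S x u).-integrable [set: W] (fun w => (stage_cost S x u w)%:E) ;
  mean_cost_ge0 : forall x u, controls S x u -> 0 <= mean_cost S x u ;
  dest_absorbing : forall u w, controls S (destination S) u ->
    dynamics S (destination S) u w = destination S ;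
  dest_cost_free : forall u w, controls S (destination S) u ->
    stage_cost S (destination S) u w = 0%R }.

Definition policy S pi : Prop := forall k x, controls S x (pi k x).

Definition stationary mu : nat -> X -> U := fun _ => mu.

(* The policy that [pi] induces from stage 1 on. *)
Definition shift_policy pi : nat -> X -> U := fun k => pi k.+1.

(* [state S pi x [:: w_0; ...; w_(k-1)]] is the state x_k reached from x_0 = x,
   and [history_prob S pi x [:: w_0; ...; w_(k-1)]] is the probability of that
   disturbance history, i.e. the product of the P(w_i | x_i, pi_i(x_i)). *)
Fixpoint state S pi x (ws : seq W) : X :=
  if ws is w :: ws' then
    state S (shift_policy pi) (dynamics S x (pi 0%N x) w) ws'
  else x.

Fixpoint history_prob S pi x (ws : seq W) : \bar R :=
  if ws is w :: ws' then
    noise_law S x (pi 0%N x) [set w]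
      * history_prob S (shift_policy pi) (dynamics S x (pi 0%N x) w) ws'
  else 1.

(* E^pi_x {J(x_k)} for nonnegative J. As W is countable, the law of
   (w_0, ..., w_(k-1)) under the trajectory measure is discrete, with masses
   [history_prob]. *)
Definition expect_state S pi x k J : \bar R :=
  \esum_(ws in [set: k.-tuple W]) (history_prob S pi x ws * J (state S pi x ws)).

(* E^pi_x {g(x_k, pi_k(x_k), w_k)} is obtained by first averaging over w_k given
   x_k. This is the tower property, and it keeps the expectation meaningful
   (valued in [0, +oo]) when [stage_cost] is signed and not integrable with
   respect to the joint law of (x_k, w_k). *)
Definition policy_cost S pi x : \bar R :=
  \sum_(0 <= k <oo) expect_state S pi x k (fun y => mean_cost S y (pi k y)).

Definition opt_cost S x : \bar R :=
  ereal_inf [set policy_cost S pi x | pi in policy S].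

Definition prob_not_dest S pi x k : \bar R :=
  \esum_(ws in [set ws : k.-tuple W | state S pi x ws <> destination S])
    history_prob S pi x ws.

Definition proper_policy S x pi : Prop :=
  [/\ policy S pi, policy_cost S pi x < +oo
    & \sum_(0 <= k <oo) prob_not_dest S pi x k < +oo].

(* [ereal_inf set0 = +oo], as required when no policy is proper at x. *)
Definition opt_proper_cost S x : \bar R :=
  ereal_inf [set policy_cost S pi x | pi in proper_policy S x].

(* For an admissible [pi], the cost of [pi] in the perturbed problem is
   [policy_cost S pi x] plus [delta] times the sum over k of
   [prob_not_dest S pi x k]. *)
Definition perturb S delta : ssp_data R X U W :=
  SspData (controls S) (dynamics S) (noise_law S)
    (fun x u w => if `[< x = destination S >] then stage_cost S x u w
                  else (stage_cost S x u w + delta)%R)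
    (destination S).

Definition perturbed_opt_cost S delta x : \bar R := opt_cost (perturb S delta) x.

Definition perturbed_qfactor S delta x u : \bar R :=
  \int[noise_law S x u]_w
    ((stage_cost S x u w + delta)%:E + perturbed_opt_cost S delta (dynamics S x u w)).

Definition qfactor S J x u : \bar R :=
  \int[noise_law S x u]_w ((stage_cost S x u w)%:E + J (dynamics S x u w)).

Definition bellman S J x : \bar R :=
  ereal_inf [set qfactor S J x u | u in controls S x].

Definition bellman_argmin S J x : set U :=
  [set u | controls S x u /\ qfactor S J x u = bellman S J x].

Definition cost_function S J : Prop := (forall x, 0 <= J x) /\ J (destination S) = 0.

Definition What S : set (X -> \bar R) :=
  [set J | [/\ cost_function S J,
      forall x, opt_proper_cost S x <= J x
    & forall pi x, proper_policy S x pi ->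
        (fun k => expect_state S pi x k J) @ \oo --> 0]].

End ssp.

(* Main.v *)
Require Import Defs.
From HB Require Import structures.
From mathcomp Require Import all_boot all_order all_algebra.
From mathcomp Require Import all_classical all_reals all_analysis.
From mathcomp Require Import measurable_realfun.
Set Implicit Arguments.
Unset Strict Implicit.
Unset Printing Implicit Defensive.
Import Order.TTheory GRing.Theory Num.Theory.
Import numFieldNormedType.Exports.
Local Open Scope classical_set_scope.
Local Open Scope ring_scope.
Local Open Scope ereal_scope.

(** Write J^ for the optimal cost over proper policies, J_d for the optimal cost
of the d-perturbed problem, T for the Bellman operator and r_k for the
probability of being away from the destination at time k.

Dynamic programming with nonnegative costs applies to the original problem and
to each perturbed one. Because the controls are chosen state by state, one
Markov policy can be nearly greedy at all states at once, with errors that are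
summable in time. If J >= 0 and T J <= J, such a policy costs at most J plus
the total error, so that opt_cost <= J. Since opt_cost itself satisfies this
inequality, it is the least such J, and hence a fixed point of T
([superharmonic_near_opt], [opt_cost_bellman]).

Perturbation makes properness visible in the cost. The perturbed cost of a
policy is its cost plus d times the sum of the r_k ([policy_cost_perturb]), so a
policy is proper at x exactly when this is finite ([proper_policyE]). It follows
that J^ <= J_d and that J_d decreases to J^ as d tends to 0
([perturbed_opt_cost_cvg]). Taking the limit in the Bellman equations of the J_d
gives T J^ <= J^ at once. The opposite inequality needs the limit of the
expectation of J_d at the next state, which is taken over a decreasing family:
dominated convergence applies where the Q-factors of one perturbed problem are
finite, that is, at the states with finite optimal cost
([next_mean_perturbed_cvg]). At the other states both sides are infinite, since
J^ dominates opt_cost, which is a fixed point ([opt_proper_cost_bellman]).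

J^ has the vanishing property that defines the set What because its mean at
time k is at most the tail, from k on, of a convergent series of perturbed
stage costs ([opt_proper_cost_What]). For value iteration from J_0 in this set,
monotonicity keeps the iterates above J^, and comparison with an arbitrary
policy that is proper at x bounds the k-th iterate by the cost of its first k
stages plus the mean of J_0 at time k, which tends to 0
([value_iteration_cvg]). Uniqueness is the case of a constant sequence. For
stationary policies, a policy that is greedy for J^ costs at most J^, and it
costs infinity wherever J^ is infinite because opt_cost is then infinite too;
conversely the cost of a stationary policy satisfies the evaluation equation,
which says that the policy is greedy when this cost is J^. *)

(** * Integration and sums *)

(** The sum of the integrals is meaningful even if that of [g] is infinite; this
is the case that linearity for integrable functions leaves out. *)
Lemma integralD_EFin_ge0 d (T : measurableType d) (R : realType)
    (mu : {measure set T -> \bar R}) (D : set T) (f : T -> R)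
    (g : T -> \bar R) :
  measurable D -> mu.-integrable D (EFin \o f) -> measurable_fun D g ->
  (forall x, D x -> 0 <= g x) ->
  \int[mu]_(x in D) ((f x)%:E + g x) =
    \int[mu]_(x in D) (f x)%:E + \int[mu]_(x in D) g x.
Proof.
move=> mD fi mg g0; have mf := measurable_int _ fi.
have [gfin|ginfty] := ltP (\int[mu]_(x in D) g x) +oo.
  rewrite integralD//; apply/integrableP; split=> //.
  under eq_integral => x /set_mem Dx do rewrite gee0_abs ?g0//.
  exact: gfin.
have {}ginfty : \int[mu]_(x in D) g x = +oo by apply/eqP; rewrite -leye_eq.
have msum : measurable_fun D (fun x => (f x)%:E + g x).
  exact: emeasurable_funD.
set h := fun x => (f x)%:E + g x.
(* The negative part of the sum is at most that of [f]; when the integral of [g]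
   is infinite, so is that of the positive part, since g <= h^+ + f^-. *)
have hneg : \int[mu]_(x in D) h^\- x < +oo.
  apply: le_lt_trans (integral_funeneg_lt_pinfty mD fi).
  apply: ge0_le_integral => //; try exact: measurable_funeneg.
  move=> x Dx; apply: (@funeneg_le _ _ D) => [y /set_mem Dy|];
    last exact/mem_set.
  by rewrite /= leeDl// g0.
have hpos : \int[mu]_(x in D) h^\+ x = +oo.
  have : +oo <= \int[mu]_(x in D) h^\+ x + \int[mu]_(x in D) (EFin \o f)^\- x.
    rewrite -ginfty -ge0_integralD//; try exact: measurable_funepos;
      try exact: measurable_funeneg.
    apply: ge0_le_integral => //.
    - apply: emeasurable_funD; first exact: measurable_funepos.
      exact: measurable_funeneg.
    - move=> x Dx; have gE : g x = h x + (- f x)%:E.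
        by rewrite /h addeAC -EFinD subrr add0e.
      by rewrite [leLHS]gE leeD// ?funeposE ?funenegE le_max lexx.
  have : \int[mu]_(x in D) (EFin \o f)^\- x < +oo.
    exact: integral_funeneg_lt_pinfty.
  have : 0 <= \int[mu]_(x in D) (EFin \o f)^\- x by exact: integral_ge0.
  case: (integral _ _ (EFin \o f)^\-) => //= r _ _.
  by case: (integral _ _ h^\+).
rewrite ginfty addey; last first.
  by have /fin_numP[] := integrable_fin_num mD fi.
rewrite integralE hpos addye//.
have : 0 <= \int[mu]_(x in D) h^\- x by exact: integral_ge0.
by move: hneg; case: (integral _ _ h^\-).
Qed.

(** * Disturbances, expectations and stage costs *)
Section discrete.
Context {d : measure_display} {W : measurableType d} {R : realType}.
Context (discW : forall A : set W, measurable A).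
Context (cntW : countable [set: W]).

Lemma measurable_discrete d' (T : sigmaRingType d') (D : set W) (f : W -> T) :
  measurable_fun D f.
Proof. by []. Qed.

Lemma integral_discrete (P : {measure set W -> \bar R}) (F : W -> \bar R) :
  (forall w, 0 <= F w) ->
  \int[P]_w F w = \esum_(w in [set: W]) (P [set w] * F w).
Proof.
move=> F0; have /countable_injP[f finj] := cntW.
(* The fibres of an injection into nat split W into singletons and empty
   sets. *)
pose A k := f @^-1` [set k].
have UA : [set: W] = \bigcup_k A k.
  by apply/seteqP; split=> // w _; exists (f w).
have tA : trivIset setT A.
  apply/trivIsetP => i j _ _ ij; rewrite -preimage_setI.
  by apply/seteqP; split=> // w /= [-> /eqP]; rewrite (negbTE ij).
rewrite UA ge0_integral_bigcup//.
rewrite nneseries_sum_bigcup// => [|w]; last exact: mule_ge0.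
apply: eq_eseriesr => k _.
have [->|/set0P[w wk]] := eqVneq (A k) set0.
  by rewrite integral_set0 esum_set0.
have -> : A k = [set w].
  apply/seteqP; split=> [v vk|_ ->//].
  by apply: finj; rewrite ?in_setT// vk wk.
rewrite esum_set1; last exact: mule_ge0.
rewrite (@eq_integral _ _ _ _ _ (cst (F w))) => [|v /set_mem ->//].
by rewrite integral_cst// muleC.
Qed.

End discrete.

Lemma ge0_esumZl (R : realType) (T : choiceType) (I : set T) (r : R)
    (a : T -> \bar R) :
  (0 <= r)%R -> (forall i, 0 <= a i) ->
  \esum_(i in I) (r%:E * a i) = r%:E * \esum_(i in I) a i.
Proof.
move=> r0 a0; rewrite /esum -ereal_supZl//; last first.
  apply/set0P; exists 0; exists set0 => //=; first exact: fsets_set0.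
  by rewrite fsbig_set0.
congr ereal_sup; apply/seteqP; split=> x /=.
  move=> [A [finA AI] <-]; exists (\sum_(i \in A) a i); first by exists A.
  by rewrite ge0_mule_fsumr.
move=> [_ [A [finA AI] <-] <-]; exists A => //.
by rewrite ge0_mule_fsumr.
Qed.

Lemma le_limn_esup (R : realType) (u v : (\bar R)^nat) :
  (forall n, u n <= v n) -> limn_esup u <= limn_esup v.
Proof.
move=> uv; apply/ereal_infP => _ [V ooV <-].
apply: ge_ereal_inf; exists (ereal_sup (u @` V)); first by exists V.
apply/ereal_supP => _ [n Vn <-]; apply: le_trans (uv n) _.
by apply: ereal_sup_ubound; exists n.
Qed.

Section model.
Context {R : realType} {X U : Type} {d : measure_display}
  {W : measurableType d} (S : ssp_data R X U W).
Implicit Types (pi : nat -> X -> U) (J : X -> \bar R) (x : X) (u : U)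
  (k : nat).

(** The mean of [J] at the next state. It is an integral like the Q-factors,
which gives access to monotone and dominated convergence; the finite-horizon
expectations, sums over histories, are reduced to it in [expect_stateS]. *)
Definition next_mean x u J : \bar R :=
  \int[noise_law S x u]_w J (dynamics S x u w).

Context (hS : stochastic_shortest_path S).
Let disc : forall A : set W, measurable A := disturbances_discrete hS.

Lemma next_mean_ge0 x u J : (forall y, 0 <= J y) -> 0 <= next_mean x u J.
Proof. by move=> J0; exact: integral_ge0. Qed.

Lemma le_next_mean x u J J' : (forall y, 0 <= J y) -> (forall y, J y <= J' y) ->
  next_mean x u J <= next_mean x u J'.
Proof.
by move=> J0 JJ'; apply: ge0_le_integral => //; exact: measurable_discrete.
Qed.

Lemma next_meanD x u J J' : (forall y, 0 <= J y) -> (forall y, 0 <= J' y) ->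
  next_mean x u (fun y => J y + J' y) = next_mean x u J + next_mean x u J'.
Proof.
by move=> J0 J'0; apply: ge0_integralD => //; exact: measurable_discrete.
Qed.

Lemma next_mean_cst x u (r : \bar R) : next_mean x u (cst r) = r.
Proof.
by rewrite /next_mean integral_cst//= probability_setT mule1.
Qed.

Lemma next_mean_series x u (F : nat -> X -> \bar R) :
  (forall k y, 0 <= F k y) ->
  next_mean x u (fun y => \sum_(0 <= k <oo) F k y) =
    \sum_(0 <= k <oo) next_mean x u (F k).
Proof.
by move=> F0; apply: integral_nneseries => // k; exact: measurable_discrete.
Qed.

Lemma next_mean_sum x u (F : nat -> X -> \bar R) n :
  (forall k y, 0 <= F k y) ->
  next_mean x u (fun y => \sum_(0 <= k < n) F k y) =
    \sum_(0 <= k < n) next_mean x u (F k).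
Proof.
by move=> F0; apply: ge0_integral_sum => // k; exact: measurable_discrete.
Qed.

(** Only the mean of the stage cost is nonnegative, so this splitting is what
lets all later arguments work with nonnegative terms. *)
Lemma qfactorE x u J : controls S x u -> (forall y, 0 <= J y) ->
  qfactor S J x u = mean_cost S x u + next_mean x u J.
Proof.
move=> xu J0; apply: integralD_EFin_ge0 => //.
exact: stage_cost_integrable.
Qed.

Lemma history_prob_ge0 pi x (ws : seq W) : 0 <= history_prob S pi x ws.
Proof. by elim: ws pi x => //= w ws IH pi x; exact: mule_ge0. Qed.

Lemma expect_state_ge0 pi x k J : (forall y, 0 <= J y) ->
  0 <= expect_state S pi x k J.
Proof.
move=> J0; apply: esum_ge0 => ws _; apply: mule_ge0 => //.
exact: history_prob_ge0.
Qed.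

Lemma expect_state0 pi x J : (forall y, 0 <= J y) ->
  expect_state S pi x 0 J = J x.
Proof.
move=> J0; rewrite /expect_state.
have -> : [set: 0.-tuple W]%classic = [set [tuple]]%classic.
  by apply/seteqP; split=> t // _; apply: tuple0.
by rewrite esum_set1/= mul1e.
Qed.

(** First-step decomposition: a history of length k+1 is a first disturbance
followed by a history of length k of the shifted policy. All the facts about
horizon k below are inductions on this equation. *)
Lemma expect_stateS pi x k J : (forall y, 0 <= J y) ->
  expect_state S pi x k.+1 J =
    next_mean x (pi 0%N x) (fun y => expect_state S (shift_policy pi) y k J).
Proof.
move=> J0; rewrite /next_mean.
rewrite (integral_discrete disc (disturbances_countable hS));
  last first.
  by move=> w; exact: expect_state_ge0.
set p := noise_law S x (pi 0%N x).
pose a w (ws : k.-tuple W) := p [set w] * (history_prob S (shift_policy pi)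
  (dynamics S x (pi 0%N x) w) ws * J (state S (shift_policy pi)
  (dynamics S x (pi 0%N x) w) ws)).
have a0 w ws : 0 <= a w ws.
  by rewrite /a mule_ge0// mule_ge0//; exact: history_prob_ge0.
transitivity (\esum_(w in [set: W]) \esum_(ws in [set: k.-tuple W]) a w ws).
  rewrite esum_esum//.
  rewrite /expect_state (reindex_esum ([set: W] `*`` (fun=> [set: k.-tuple W]))
    _ (fun z => cons_tuple z.1 z.2)).
    by apply: eq_esum => -[w ws] _ /=; rewrite /a muleA.
  split=> [//|[w ws] [w' ws'] _ _ /= /(congr1 val)/= [-> e]|t _ /=].
    by congr pair; exact/val_inj.
  exists (thead t, [tuple of behead t]) => //=.
  by rewrite [RHS]tuple_eta; exact/val_inj.
apply: eq_esum => w _; rewrite /a.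
have pfin : p [set w] \is a fin_num by exact: fin_num_measure.
rewrite -(fineK pfin) ge0_esumZl ?fine_ge0//; first by rewrite fineK.
by move=> ws; apply: mule_ge0 => //; exact: history_prob_ge0.
Qed.

Lemma le_expect_state pi x k J J' : (forall y, 0 <= J y) ->
  (forall y, J y <= J' y) ->
  expect_state S pi x k J <= expect_state S pi x k J'.
Proof.
move=> J0 JJ'; apply: le_esum => ws _.
by apply: lee_wpmul2l => //; exact: history_prob_ge0.
Qed.

Definition stage_mean pi x k : \bar R :=
  expect_state S pi x k (fun y => mean_cost S y (pi k y)).

Lemma shift_policyP pi : policy S pi -> policy S (shift_policy pi).
Proof. by move=> Ppi k; exact: Ppi. Qed.

Lemma mean_cost_policy_ge0 pi k x : policy S pi -> 0 <= mean_cost S x (pi k x).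
Proof. by move=> Ppi; apply: mean_cost_ge0 => //; exact: Ppi. Qed.

Lemma stage_mean_ge0 pi x k : policy S pi -> 0 <= stage_mean pi x k.
Proof.
by move=> Ppi; apply: expect_state_ge0 => y; exact: mean_cost_policy_ge0.
Qed.

Lemma stage_mean0 pi x : policy S pi ->
  stage_mean pi x 0 = mean_cost S x (pi 0%N x).
Proof.
move=> Ppi; rewrite /stage_mean expect_state0// => y.
exact: mean_cost_policy_ge0.
Qed.

Lemma stage_meanS pi x k : policy S pi ->
  stage_mean pi x k.+1 =
    next_mean x (pi 0%N x) (fun y => stage_mean (shift_policy pi) y k).
Proof.
move=> Ppi; rewrite /stage_mean expect_stateS// => y.
exact: mean_cost_policy_ge0.
Qed.

Lemma policy_cost_ge0 pi x : policy S pi -> 0 <= policy_cost S pi x.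
Proof. by move=> Ppi; apply: nneseries_ge0 => k _ _; exact: stage_mean_ge0. Qed.

Lemma policy_iter_shift pi k : policy S pi -> policy S (iter k shift_policy pi).
Proof. by move=> Ppi; elim: k => //= k; exact: shift_policyP. Qed.

(** Markov property: continuing from the state at time k with the rest of the
policy costs, on average, the tail of the series of stage costs. *)
Lemma expect_policy_cost pi x k : policy S pi ->
  expect_state S pi x k (policy_cost S (iter k shift_policy pi)) =
    \sum_(k <= m <oo) stage_mean pi x m.
Proof.
elim: k pi x => [|k IH] pi x Ppi.
  by rewrite expect_state0// => y; exact: policy_cost_ge0.
have P' := shift_policyP Ppi.
rewrite expect_stateS; last first.
  by move=> y; apply: policy_cost_ge0; exact: policy_iter_shift.
rewrite iterSr (_ : (fun y => _) = fun y =>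
    \sum_(0 <= m <oo) stage_mean (shift_policy pi) y (m + k)); last first.
  apply/funext => y; rewrite IH// -nneseries_addn// => i.
  exact: stage_mean_ge0.
rewrite next_mean_series => [|i y]; last exact: stage_mean_ge0.
rewrite -(nneseries_addn k.+1); last by move=> i; exact: stage_mean_ge0.
by apply: eq_eseriesr => i _; rewrite addnS stage_meanS.
Qed.

Lemma policy_costS pi x : policy S pi ->
  policy_cost S pi x =
    mean_cost S x (pi 0%N x) +
    next_mean x (pi 0%N x) (policy_cost S (shift_policy pi)).
Proof.
move=> Ppi; have P' := shift_policyP Ppi.
rewrite /policy_cost nneseries_recl// => [|k _]; last exact: stage_mean_ge0.
rewrite -/(stage_mean _ _ _) stage_mean0//; congr (_ + _).
rewrite -(expect_policy_cost _ 1)// expect_stateS; last first.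
  by move=> y; exact: policy_cost_ge0.
congr next_mean; apply/funext => y; rewrite expect_state0// => z.
exact: policy_cost_ge0.
Qed.

Lemma expect_policy_cost_cvg0 pi x : policy S pi -> policy_cost S pi x < +oo ->
  (fun k => expect_state S pi x k (policy_cost S (iter k shift_policy pi)))
    @ \oo --> 0.
Proof.
move=> Ppi fin; under eq_fun do rewrite expect_policy_cost//.
by apply: nneseries_tail_cvg => // k _; exact: stage_mean_ge0.
Qed.

(** * Dynamic programming with nonnegative costs *)
Definition partial_cost n pi x : \bar R := \sum_(0 <= k < n) stage_mean pi x k.

Lemma partial_cost_ge0 n pi x : policy S pi -> 0 <= partial_cost n pi x.
Proof. by move=> Ppi; apply: sume_ge0 => k _; exact: stage_mean_ge0. Qed.

Lemma partial_costS n pi x : policy S pi ->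
  partial_cost n.+1 pi x =
    mean_cost S x (pi 0%N x) +
    next_mean x (pi 0%N x) (partial_cost n (shift_policy pi)).
Proof.
move=> Ppi; rewrite /partial_cost big_nat_recl// stage_mean0//; congr (_ + _).
rewrite next_mean_sum => [|k y]; last exact/stage_mean_ge0/shift_policyP.
by apply: eq_bigr => k _; rewrite stage_meanS.
Qed.

Lemma partial_cost_cvg pi x : policy S pi ->
  (fun n => partial_cost n pi x) @ \oo --> policy_cost S pi x.
Proof.
by move=> Ppi; apply: is_cvg_nneseries => k _ _; exact: stage_mean_ge0.
Qed.

Lemma policy_cost_le pi x (c : \bar R) : policy S pi ->
  (forall n, partial_cost n pi x <= c) -> policy_cost S pi x <= c.
Proof.
move=> Ppi H; apply: lime_le; last exact: nearW.
exact/cvg_ex/ex_intro/partial_cost_cvg.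
Qed.

Lemma qfactor_ge0 x u J : controls S x u -> (forall y, 0 <= J y) ->
  0 <= qfactor S J x u.
Proof.
move=> xu J0; rewrite qfactorE// adde_ge0//; last exact: next_mean_ge0.
exact: mean_cost_ge0.
Qed.

Lemma le_qfactor x u J J' : controls S x u -> (forall y, 0 <= J y) ->
  (forall y, J y <= J' y) -> qfactor S J x u <= qfactor S J' x u.
Proof.
move=> xu J0 JJ'; have J'0 y : 0 <= J' y by exact: le_trans (JJ' y).
by rewrite !qfactorE// leeD2l// le_next_mean.
Qed.

Lemma bellman_ge0 J x : (forall y, 0 <= J y) -> 0 <= bellman S J x.
Proof. by move=> J0; apply/ereal_infP => _ [u xu <-]; exact: qfactor_ge0. Qed.

Lemma bellman_le J x u : controls S x u -> bellman S J x <= qfactor S J x u.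
Proof. by move=> xu; apply: ereal_inf_lbound; exists u. Qed.

Lemma le_bellman J J' x : (forall y, 0 <= J y) -> (forall y, J y <= J' y) ->
  bellman S J x <= bellman S J' x.
Proof.
move=> J0 JJ'; apply/ereal_infP => _ [u xu <-].
by apply: le_trans (bellman_le J xu) _; exact: le_qfactor.
Qed.

Lemma policy_cost_qfactor pi x : policy S pi ->
  policy_cost S pi x = qfactor S (policy_cost S (shift_policy pi)) x (pi 0%N x).
Proof.
move=> Ppi; rewrite policy_costS// qfactorE// => y.
exact/policy_cost_ge0/shift_policyP.
Qed.

(** If the infimum is infinite any control will do, and there is one. *)
Lemma near_greedy_control J x (e : R) : (forall y, 0 <= J y) -> (0 < e)%R ->
  exists u, controls S x u /\ qfactor S J x u <= bellman S J x + e%:E.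
Proof.
move=> J0 e0; have [fin|] := ltP (bellman S J x) +oo.
  have fn : bellman S J x \is a fin_num by rewrite ge0_fin_numE// bellman_ge0.
  by have [_ [u xu <-] /ltW ?] := lb_ereal_inf_adherent e0 fn; exists u.
rewrite leye_eq => /eqP ->; have [u xu] := controls_nonempty hS x.
by exists u; split=> //; rewrite addye// leey.
Qed.

(** The errors [e k] are constants, so averaging over the next state leaves them
unchanged and they simply add up along the horizon. *)
Lemma partial_cost_near_greedy pi J (e : nat -> R) n x : policy S pi ->
  (forall y, 0 <= J y) -> (forall k, 0 <= e k)%R ->
  (forall k y, qfactor S J y (pi k y) <= J y + (e k)%:E) ->
  partial_cost n pi x <= J x + \sum_(0 <= k < n) (e k)%:E.
Proof.
elim: n pi e x => [|n IH] pi e x Ppi J0 e0 greedy.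
  by rewrite /partial_cost !big_nil adde0.
have P' := shift_policyP Ppi.
rewrite partial_costS// big_nat_recl// [leRHS]addeA.
apply: le_trans (leeD2r _ (greedy 0%N x)).
rewrite qfactorE// -[leRHS]addeA; apply: leeD2l.
rewrite -[X in _ <= _ + X](next_mean_cst x (pi 0%N x)) -next_meanD//;
  last first.
  by move=> y; apply: sume_ge0 => k _; rewrite lee_fin.
apply: le_next_mean => y; first exact: partial_cost_ge0.
by apply: (IH _ (fun k => e k.+1)) => [| |k|k z] //; exact: (greedy k.+1).
Qed.

(** A single policy works for all initial states, because the near-greedy
control is chosen separately at each time and state; the errors e / 2^(k+1)
sum to [e]. *)
Lemma superharmonic_near_opt J (e : R) : (forall y, 0 <= J y) ->
  (forall y, bellman S J y <= J y) -> (0 < e)%R ->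
  exists2 pi, policy S pi & forall x, policy_cost S pi x <= J x + e%:E.
Proof.
move=> J0 TJ e0; pose ek k : R := (e / (2 ^ k.+1)%:R)%R.
have ek0 k : (0 < ek k)%R by rewrite divr_gt0// ltr0n expn_gt0.
have /choice[pi Hpi] : forall k, exists mu : X -> U, forall y,
    controls S y (mu y) /\ qfactor S J y (mu y) <= bellman S J y + (ek k)%:E.
  move=> k; have /choice[mu] := fun y => near_greedy_control y J0 (ek0 k).
  by exists mu.
have Ppi : policy S pi by move=> k y; have [] := Hpi k y.
exists pi => // x; apply: policy_cost_le => // n.
apply: le_trans (partial_cost_near_greedy n x Ppi J0
  (fun k => ltW (ek0 k)) _) _.
  by move=> k y; have [_ /le_trans->//] := Hpi k y; rewrite leeD2r.
rewrite leeD2l//; apply: le_trans (epsilon_trick0 xpredT (ltW e0)).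
by apply: nneseries_lim_ge => k _ _; rewrite lee_fin ltW// ek0.
Qed.

Lemma opt_cost_ge0 x : 0 <= opt_cost S x.
Proof. by apply/ereal_infP => _ [pi Ppi <-]; exact: policy_cost_ge0. Qed.

Lemma opt_cost_le pi x : policy S pi -> opt_cost S x <= policy_cost S pi x.
Proof. by move=> Ppi; apply: ereal_inf_lbound; exists pi. Qed.

Lemma opt_cost_superharmonic J x : (forall y, 0 <= J y) ->
  (forall y, bellman S J y <= J y) -> opt_cost S x <= J x.
Proof.
move=> J0 TJ; apply/lee_addgt0Pr => e e0.
have [pi Ppi /(_ x)] := superharmonic_near_opt J0 TJ e0.
by apply: le_trans; exact: opt_cost_le.
Qed.

(** Dropping the first stage of a policy shows that opt_cost is superharmonic:
its image by the Bellman operator lies below it. Then so is this image, by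
monotonicity, and opt_cost lies below every superharmonic function. *)
Lemma opt_cost_bellman x : opt_cost S x = bellman S (opt_cost S) x.
Proof.
have T_le y : bellman S (opt_cost S) y <= opt_cost S y.
  apply/ereal_infP => _ [pi Ppi <-]; rewrite policy_cost_qfactor//.
  apply: le_trans (bellman_le _ (Ppi 0%N y)) _.
  apply: le_qfactor => // z; first exact: opt_cost_ge0.
  exact/opt_cost_le/shift_policyP.
apply/eqP; rewrite eq_le T_le andbT; apply: opt_cost_superharmonic => y.
  by apply: bellman_ge0 => z; exact: opt_cost_ge0.
by apply: le_bellman => // z; apply: bellman_ge0 => ?; exact: opt_cost_ge0.
Qed.

End model.

(** * The perturbed problems *)
Section perturbation.
Context {R : realType} {X U : Type} {d : measure_display}
  {W : measurableType d} (S : ssp_data R X U W).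
Implicit Types (pi : nat -> X -> U) (J : X -> \bar R) (x y : X) (u : U)
  (k : nat) (delta : R).

Definition not_dest x : \bar R := if `[< x = destination S >] then 0 else 1.

Lemma not_dest_ge0 x : 0 <= not_dest x.
Proof. by rewrite /not_dest; case: ifP. Qed.

Lemma not_dest_le1 x : not_dest x <= 1.
Proof. by rewrite /not_dest; case: ifP. Qed.

Lemma prob_not_destE pi x k :
  prob_not_dest S pi x k = expect_state S pi x k not_dest.
Proof.
rewrite /prob_not_dest esum_mkcond; apply: eq_esum => ws _.
rewrite /not_dest; case: asboolP => [e|ne].
  by rewrite memNset ?mule0//= => /(_ e).
by rewrite mem_set ?mule1.
Qed.

Lemma expect_state_perturb delta pi x k J :
  expect_state (perturb S delta) pi x k J = expect_state S pi x k J.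
Proof.
apply: eq_esum => ws _; congr (_ * J _).
  by move: (val ws) => /= {ws}s; elim: s pi x => //= w s IH pi x; rewrite IH.
by move: (val ws) => /= {ws}s; elim: s pi x => //= w s IH pi x; rewrite IH.
Qed.

Context (hS : stochastic_shortest_path S).

Lemma integrable_stage_costD delta x u : controls S x u ->
  (noise_law S x u).-integrable setT (fun w => (stage_cost S x u w + delta)%:E).
Proof.
move=> xu.
apply: (@integrableD _ _ _ _ _ _ (fun w => (stage_cost S x u w)%:E)
  (cst delta%:E)) => //.
  exact: stage_cost_integrable.
exact: finite_measure_integrable_cst.
Qed.

Lemma integral_stage_costD delta x u : controls S x u ->
  \int[noise_law S x u]_w (stage_cost S x u w + delta)%:E =
    mean_cost S x u + delta%:E.
Proof.
move=> xu.
rewrite (@integralD _ _ _ _ _ _ (fun w => (stage_cost S x u w)%:E)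
  (cst delta%:E))//.
- by rewrite integral_cst//= probability_setT mule1.
- exact: stage_cost_integrable.
- exact: finite_measure_integrable_cst.
Qed.

Lemma mean_cost_perturb delta x u : controls S x u ->
  mean_cost (perturb S delta) x u = mean_cost S x u + delta%:E * not_dest x.
Proof.
move=> xu; rewrite /mean_cost /= /not_dest; case: asboolP => _.
  by rewrite mule0 adde0.
by rewrite integral_stage_costD// mule1.
Qed.

(** Consequently everything proved for a general problem, in particular the
Bellman equation, holds for the perturbed ones. *)
Lemma perturb_ssp delta : (0 <= delta)%R ->
  stochastic_shortest_path (perturb S delta).
Proof.
move=> d0; split => /=.
- exact: disturbances_countable hS.
- exact: disturbances_discrete hS.
- exact: controls_nonempty hS.
- move=> x u xu; case: asboolP => _; first exact: stage_cost_integrable.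
  exact: integrable_stage_costD.
- move=> x u xu; rewrite mean_cost_perturb// adde_ge0//.
    exact: mean_cost_ge0.
  by rewrite mule_ge0 ?lee_fin ?not_dest_ge0.
- exact: dest_absorbing hS.
- by move=> u w tu; rewrite asboolT// dest_cost_free.
Qed.

(** The expected time before the destination is reached, as a sum of tail
probabilities. *)
Definition expected_time pi x : \bar R :=
  \sum_(0 <= k <oo) prob_not_dest S pi x k.

Lemma prob_not_dest_ge0 pi x k : 0 <= prob_not_dest S pi x k.
Proof.
by rewrite prob_not_destE expect_state_ge0// => y; exact: not_dest_ge0.
Qed.

Lemma expected_time_ge0 pi x : 0 <= expected_time pi x.
Proof. by apply: nneseries_ge0 => k _ _; exact: prob_not_dest_ge0. Qed.

Lemma policy_cost_perturb delta pi x : (0 <= delta)%R -> policy S pi ->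
  policy_cost (perturb S delta) pi x =
    policy_cost S pi x + delta%:E * expected_time pi x.
Proof.
move=> d0 Ppi; rewrite /policy_cost /expected_time -nneseriesZl; last first.
  by move=> k _; exact: prob_not_dest_ge0.
rewrite -nneseriesD; last 2 first.
- by move=> k _ _; exact: stage_mean_ge0.
- by move=> k _ _; rewrite mule_ge0 ?lee_fin ?prob_not_dest_ge0.
apply: eq_eseriesr => k _; rewrite expect_state_perturb prob_not_destE.
rewrite /expect_state -ge0_esumZl//; last first.
  by move=> ws; rewrite mule_ge0 ?history_prob_ge0 ?not_dest_ge0.
rewrite -esumD; last 2 first.
- by move=> ws _; rewrite mule_ge0 ?history_prob_ge0 ?mean_cost_policy_ge0.
- by move=> ws _; rewrite !mule_ge0 ?lee_fin ?history_prob_ge0 ?not_dest_ge0.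
apply: eq_esum => ws _; rewrite mean_cost_perturb; last exact: Ppi.
rewrite ge0_muleDr ?mean_cost_policy_ge0//; last first.
  by rewrite mule_ge0 ?lee_fin ?not_dest_ge0.
by rewrite muleCA.
Qed.

Lemma policy_cost_le_perturb delta pi x : (0 <= delta)%R -> policy S pi ->
  policy_cost S pi x <= policy_cost (perturb S delta) pi x.
Proof.
move=> d0 Ppi; rewrite policy_cost_perturb// leeDl//.
by rewrite mule_ge0 ?lee_fin ?expected_time_ge0.
Qed.

(** Both terms of [policy_cost_perturb] are nonnegative and [delta] is positive,
so the sum is finite exactly when each term is. *)
Lemma proper_policyE delta pi x : (0 < delta)%R -> policy S pi ->
  proper_policy S x pi <-> policy_cost (perturb S delta) pi x < +oo.
Proof.
move=> d0 Ppi; have d0' := ltW d0; rewrite policy_cost_perturb//.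
have c0 := policy_cost_ge0 hS x Ppi; have t0 := expected_time_ge0 pi x.
split=> [[_ cfin tfin]|fin].
  by apply: lte_add_pinfty => //; apply: lte_mul_pinfty.
split=> //.
  by apply: le_lt_trans fin; rewrite leeDl// mule_ge0.
rewrite -/(expected_time pi x) ltey; apply/eqP => tE; move: fin.
by rewrite tE gt0_muley ?lte_fin// addey ?ltxx// gt_eqF// (lt_le_trans _ c0).
Qed.

Lemma perturbed_opt_cost_ge0 delta x : (0 <= delta)%R ->
  0 <= perturbed_opt_cost S delta x.
Proof. by move=> d0; apply: opt_cost_ge0; exact: perturb_ssp. Qed.

Lemma le_perturbed_opt_cost delta delta' x : (0 <= delta)%R ->
  (delta <= delta')%R ->
  perturbed_opt_cost S delta x <= perturbed_opt_cost S delta' x.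
Proof.
move=> d0 dd'; apply/ereal_infP => _ [pi Ppi <-].
apply: (@le_trans _ _ (policy_cost (perturb S delta) pi x)).
  by apply: ereal_inf_lbound; exists pi.
rewrite !policy_cost_perturb// ?(le_trans d0)// leeD2l//.
by rewrite lee_wpmul2r ?lee_fin ?expected_time_ge0.
Qed.

Lemma opt_proper_cost_ge0 x : 0 <= opt_proper_cost S x.
Proof. by apply/ereal_infP => _ [pi [Ppi _ _] <-]; exact: policy_cost_ge0. Qed.

Lemma opt_cost_le_proper x : opt_cost S x <= opt_proper_cost S x.
Proof. by apply: ereal_inf_le_tmp => _ [pi [Ppi _ _] <-]; exists pi. Qed.

(** An improper policy has infinite perturbed cost. Bounds along a trajectory
therefore follow without tracking at which states the policy remains proper. *)
Lemma opt_proper_cost_le_perturb delta pi x : (0 < delta)%R -> policy S pi ->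
  opt_proper_cost S x <= policy_cost (perturb S delta) pi x.
Proof.
move=> d0 Ppi.
have [fin|] := ltP (policy_cost (perturb S delta) pi x) +oo; last first.
  by rewrite leye_eq => /eqP ->; rewrite leey.
apply: le_trans (policy_cost_le_perturb x (ltW d0) Ppi).
apply: ereal_inf_lbound; exists pi; last by [].
exact/(proper_policyE x d0 Ppi).
Qed.

Lemma opt_proper_cost_le_perturbed delta x : (0 < delta)%R ->
  opt_proper_cost S x <= perturbed_opt_cost S delta x.
Proof.
move=> d0; apply/ereal_infP => _ [pi Ppi <-].
exact: opt_proper_cost_le_perturb.
Qed.

(** The limit is an infimum over [delta], which commutes with the infimum over
policies: for a proper policy the perturbation adds a multiple of a finite
time. *)
Lemma perturbed_opt_cost_cvg delta x : (0 < delta)%R ->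
  (fun n => perturbed_opt_cost S (delta / n.+1%:R) x) @ \oo -->
    opt_proper_cost S x.
Proof.
move=> d0; have dn0 n : (0 < delta / n.+1%:R)%R by rewrite divr_gt0.
have -> : opt_proper_cost S x =
    ereal_inf (range (fun n => perturbed_opt_cost S (delta / n.+1%:R) x)).
  apply/eqP; rewrite eq_le; apply/andP; split.
    by apply/ereal_infP => _ [n _ <-]; exact: opt_proper_cost_le_perturbed.
  apply/ereal_infP => _ [pi [Ppi _ tfin] <-]; apply/lee_addgt0Pr => e e0.
  have tfn : expected_time pi x \is a fin_num.
    by rewrite ge0_fin_numE// expected_time_ge0.
  set t := fine (expected_time pi x).
  have t0 : (0 <= t)%R by rewrite fine_ge0// expected_time_ge0.
  (* With n at least delta * t / e, the n-th perturbation costs at most e. *)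
  pose n := Num.bound (delta * t / e).
  apply: (@le_trans _ _ (perturbed_opt_cost S (delta / n.+1%:R) x)).
    by apply: ereal_inf_lbound; exists n.
  apply: (@le_trans _ _ (policy_cost (perturb S (delta / n.+1%:R)) pi x)).
    by apply: ereal_inf_lbound; exists pi.
  rewrite policy_cost_perturb ?(ltW (dn0 n))// leeD2l//.
  rewrite -(fineK tfn) -EFinM lee_fin.
  rewrite mulrAC ler_pdivrMr// -ler_pdivrMl// mulrC.
  have : (delta * t / e < n%:R)%R.
    by apply: archi_boundP; rewrite divr_ge0// ?mulr_ge0 // ltW.
  by move/ltW/le_trans; apply; rewrite ler_nat.
apply: ereal_nonincreasing_cvgn => m n mn; apply: le_perturbed_opt_cost => //.
  exact/ltW.
by rewrite ler_pM2l// lef_pV2 ?posrE// ler_nat ltnS.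
Qed.

Lemma perturbed_qfactorE delta x u : (0 <= delta)%R -> controls S x u ->
  perturbed_qfactor S delta x u =
    mean_cost S x u + delta%:E + next_mean S x u (perturbed_opt_cost S delta).
Proof.
move=> d0 xu; rewrite /perturbed_qfactor integralD_EFin_ge0//.
- by rewrite integral_stage_costD.
- exact: integrable_stage_costD.
- by apply: measurable_discrete; exact: disturbances_discrete hS.
- by move=> w _; exact: perturbed_opt_cost_ge0.
Qed.

Lemma qfactor_perturb delta J x u : (0 <= delta)%R -> controls S x u ->
  (forall y, 0 <= J y) ->
  qfactor (perturb S delta) J x u =
    mean_cost S x u + delta%:E * not_dest x + next_mean S x u J.
Proof.
move=> d0 xu J0; rewrite qfactorE ?mean_cost_perturb//.
exact: perturb_ssp.
Qed.

(** At the destination the perturbed Q-factor charges [delta] although the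
perturbed stage cost does not, hence an inequality. *)
Lemma perturbed_opt_cost_le_qfactor delta x u : (0 <= delta)%R ->
  controls S x u ->
  perturbed_opt_cost S delta x <= perturbed_qfactor S delta x u.
Proof.
move=> d0 xu.
rewrite /perturbed_opt_cost opt_cost_bellman; last exact: perturb_ssp.
apply: le_trans (bellman_le _ (_ : controls (perturb S delta) x u)) _ => //.
have p0 y : 0 <= perturbed_opt_cost S delta y by exact: perturbed_opt_cost_ge0.
rewrite qfactor_perturb// perturbed_qfactorE// leeD2r// leeD2l//.
by rewrite -[leRHS]mule1 lee_wpmul2l ?lee_fin ?not_dest_le1.
Qed.

Lemma bellman_le_perturbed delta x : (0 < delta)%R ->
  bellman S (opt_proper_cost S) x <= perturbed_opt_cost S delta x.
Proof.
move=> d0; have d0' := ltW d0.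
rewrite /perturbed_opt_cost opt_cost_bellman; last exact: perturb_ssp.
have p0 y : 0 <= perturbed_opt_cost S delta y by exact: perturbed_opt_cost_ge0.
apply/ereal_infP => _ [u xu <-]; have {}xu : controls S x u by [].
rewrite qfactor_perturb//; apply: le_trans (bellman_le _ xu) _.
rewrite (qfactorE hS xu); last exact: opt_proper_cost_ge0.
apply: leeD.
  by rewrite leeDl// mule_ge0 ?lee_fin ?not_dest_ge0.
apply: (le_next_mean hS) => y; first exact: opt_proper_cost_ge0.
exact: opt_proper_cost_le_perturbed.
Qed.

Lemma bellman_opt_proper_cost_le x :
  bellman S (opt_proper_cost S) x <= opt_proper_cost S x.
Proof.
have cv := perturbed_opt_cost_cvg (x := x) (@ltr01 R).
rewrite -(cvg_lim _ cv)//; apply: lime_ge.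
  by apply/cvg_ex; exists (opt_proper_cost S x).
by apply: nearW => n; apply: bellman_le_perturbed; rewrite divr_gt0.
Qed.

End perturbation.

(** * Bellman equation under finite perturbed Q-factors *)
Section finite_qfactors.
Context {R : realType} {X U : Type} {d : measure_display}
  {W : measurableType d} (S : ssp_data R X U W).
Implicit Types (pi : nat -> X -> U) (J : X -> \bar R) (x y : X) (u : U)
  (k : nat).
Context (hS : stochastic_shortest_path S).
Context (delta : R).
Context (delta0 : (0 < delta)%R).
Context (hQ : forall x u, opt_cost S x < +oo -> controls S x u ->
  perturbed_qfactor S delta x u < +oo).

Lemma opt_proper_cost_lty x : opt_cost S x < +oo -> opt_proper_cost S x < +oo.
Proof.
move=> xfin; have [u xu] := controls_nonempty hS x.
apply: le_lt_trans (hQ xfin xu).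
apply: le_trans (opt_proper_cost_le_perturbed hS x delta0) _.
by apply: perturbed_opt_cost_le_qfactor => //; exact: ltW.
Qed.

(** A decreasing limit passes under the integral once one member of the family
is integrable; the finite Q-factor says that the one for [delta] is. *)
Lemma next_mean_perturbed_cvg x u : opt_cost S x < +oo -> controls S x u ->
  (fun n => next_mean S x u (perturbed_opt_cost S (delta / n.+1%:R))) @ \oo -->
    next_mean S x u (opt_proper_cost S).
Proof.
move=> xfin xu; have mW := disturbances_discrete hS.
have dn0 n : (0 < delta / n.+1%:R)%R by rewrite divr_gt0.
have p0 (e : R) y : (0 < e)%R -> 0 <= perturbed_opt_cost S e y.
  by move=> e0; apply: perturbed_opt_cost_ge0 => //; exact: ltW.
have mf (f : W -> \bar R) : measurable_fun setT f by exact: measurable_discrete.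
have [//| | | |_ _] := @dominated_convergence _ _ _ (noise_law S x u) setT _
  (fun n w => perturbed_opt_cost S (delta / n.+1%:R) (dynamics S x u w))
  (fun w => opt_proper_cost S (dynamics S x u w))
  (fun w => perturbed_opt_cost S delta (dynamics S x u w))
  (fun n => mf _) (mf _).
- by apply: aeW => w _; exact: perturbed_opt_cost_cvg.
- apply/integrableP; split; first exact: mf.
  under eq_integral do rewrite gee0_abs ?p0//.
  apply: le_lt_trans (hQ xfin xu).
  rewrite perturbed_qfactorE ?(ltW delta0)// leeDr// adde_ge0//.
    exact: mean_cost_ge0.
  by rewrite lee_fin ltW.
- apply: aeW => w n _; rewrite gee0_abs; last exact: p0.
  apply: (le_perturbed_opt_cost hS); first exact: ltW.
  by rewrite ler_pdivrMr// ler_peMr ?ler1n// ltW.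
- exact.
Qed.

Lemma opt_proper_cost_le_qfactor x u : opt_cost S x < +oo -> controls S x u ->
  opt_proper_cost S x <= qfactor S (opt_proper_cost S) x u.
Proof.
move=> xfin xu; rewrite qfactorE//; last exact: opt_proper_cost_ge0.
have dn0 n : (0 < delta / n.+1%:R)%R by rewrite divr_gt0.
have c_fin : mean_cost S x u \is a fin_num.
  by apply: integrable_fin_num => //; exact: stage_cost_integrable.
have cv : (fun n => mean_cost S x u + (delta / n.+1%:R)%:E +
    next_mean S x u (perturbed_opt_cost S (delta / n.+1%:R))) @ \oo -->
    mean_cost S x u + 0 + next_mean S x u (opt_proper_cost S).
  apply: cvgeD; last exact: next_mean_perturbed_cvg.
    by rewrite adde0 fin_num_adde_defr.
  apply: cvgeD; first by rewrite fin_num_adde_defr.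
    exact: cvg_cst.
  apply: cvg_EFin; first exact: nearW.
  rewrite -[X in _ --> X](mulr0 delta).
  by apply: cvgM; [exact: cvg_cst|exact: cvg_harmonic].
rewrite -[mean_cost _ _ _]adde0 -(cvg_lim _ cv)//.
apply: lime_ge; first by apply/cvg_ex; eexists; exact: cv.
apply: nearW => n; rewrite -perturbed_qfactorE//; last exact: ltW.
apply: le_trans (opt_proper_cost_le_perturbed hS x (dn0 n)) _.
by apply: perturbed_opt_cost_le_qfactor => //; exact: ltW.
Qed.

Lemma opt_proper_cost_bellman x :
  opt_proper_cost S x = bellman S (opt_proper_cost S) x.
Proof.
apply/eqP; rewrite eq_le bellman_opt_proper_cost_le// andbT.
have [xfin|] := ltP (opt_cost S x) +oo.
  by apply/ereal_infP => _ [u xu <-]; exact: opt_proper_cost_le_qfactor.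
rewrite leye_eq => /eqP xinf.
apply: (@le_trans _ _ (opt_cost S x)); first by rewrite xinf leey.
rewrite (opt_cost_bellman hS); apply: (le_bellman hS) => y.
  exact: opt_cost_ge0.
exact: opt_cost_le_proper.
Qed.

End finite_qfactors.

(** * Behaviour at the destination and membership in the solution set *)
Section destination.
Context {R : realType} {X U : Type} {d : measure_display}
  {W : measurableType d} (S : ssp_data R X U W).
Implicit Types (pi : nat -> X -> U) (J : X -> \bar R) (x y : X) (u : U)
  (k : nat).
Context (hS : stochastic_shortest_path S).

Lemma exists_policy : exists pi, policy S pi.
Proof.
by have /choice[mu Hmu] := controls_nonempty hS; exists (fun=> mu) => k x.
Qed.

Lemma stage_mean_dest pi k : policy S pi ->
  stage_mean S pi (destination S) k = 0.
Proof.
elim: k pi => [|k IH] pi Ppi.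
  rewrite stage_mean0//; apply: integral0_eq => w _ /=.
  by rewrite dest_cost_free//; exact: Ppi.
rewrite stage_meanS// /next_mean integral0_eq// => w _.
by rewrite dest_absorbing//; apply: IH; exact: shift_policyP.
Qed.

Lemma policy_cost_dest pi : policy S pi -> policy_cost S pi (destination S) = 0.
Proof.
by move=> Ppi; apply: eseries0 => k _ _; exact: stage_mean_dest.
Qed.

End destination.

Section proper_policies.
Context {R : realType} {X U : Type} {d : measure_display}
  {W : measurableType d} (S : ssp_data R X U W).
Implicit Types (pi : nat -> X -> U) (J : X -> \bar R) (x y : X) (u : U)
  (k : nat).
Context (hS : stochastic_shortest_path S).

Lemma opt_proper_cost_dest : opt_proper_cost S (destination S) = 0.
Proof.
apply/eqP; rewrite eq_le opt_proper_cost_ge0// andbT.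
have [pi Ppi] := exists_policy hS.
have -> : 0 = policy_cost (perturb S 1) pi (destination S).
  rewrite -[destination S]/(destination (perturb S 1)).
  by rewrite (policy_cost_dest (perturb_ssp hS ler01)).
exact: opt_proper_cost_le_perturb.
Qed.

(** The perturbation with delta = 1 turns properness into finiteness of a cost:
J^ lies below the perturbed cost of every continuation of the policy, whose mean
at time k is the tail of a convergent series. *)
Lemma opt_proper_cost_What : What S (opt_proper_cost S).
Proof.
split=> //.
  by split; [exact: opt_proper_cost_ge0|exact: opt_proper_cost_dest].
move=> pi x properP; have [Ppi _ _] := properP.
have hS1 := perturb_ssp hS ler01.
have /(expect_policy_cost_cvg0 hS1 Ppi) :=
  proj1 (proper_policyE hS x ltr01 Ppi) properP.
apply: squeeze_cvge (cvg_cst 0); apply: nearW => k.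
rewrite expect_state_ge0//=; last exact: opt_proper_cost_ge0.
rewrite expect_state_perturb; apply: le_expect_state => y.
  exact: opt_proper_cost_ge0.
apply: opt_proper_cost_le_perturb => //; exact: (policy_iter_shift k Ppi).
Qed.

(** * Value iteration *)
Section value_iteration.
Context (Jk : nat -> X -> \bar R).
Context (Jk0 : forall x, 0 <= Jk 0%N x).
Context (JkS : forall k x, Jk k.+1 x = bellman S (Jk k) x).

Lemma value_iteration_ge0 k x : 0 <= Jk k x.
Proof. by elim: k x => // k IH x; rewrite JkS bellman_ge0. Qed.

(** Following a policy for k stages and then paying [Jk 0] is never better than
minimizing at each stage. *)
Lemma value_iteration_le pi k x : policy S pi ->
  Jk k x <= partial_cost S k pi x + expect_state S pi x k (Jk 0%N).
Proof.
elim: k pi x => [|k IH] pi x Ppi.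
  by rewrite /partial_cost big_nil add0e expect_state0.
have P' := shift_policyP Ppi.
rewrite JkS; apply: le_trans (bellman_le _ (Ppi 0%N x)) _.
rewrite qfactorE//; last exact: value_iteration_ge0.
rewrite partial_costS// expect_stateS// -[leRHS]addeA; apply: leeD2l.
rewrite -next_meanD//; last 2 first.
- by move=> y; exact: partial_cost_ge0.
- by move=> y; exact: expect_state_ge0.
by apply: le_next_mean => // y; [exact: value_iteration_ge0|exact: IH].
Qed.

Lemma value_iteration_ge J k x : (forall y, 0 <= J y) ->
  (forall y, J y = bellman S J y) -> (forall y, J y <= Jk 0%N y) ->
  J x <= Jk k x.
Proof.
move=> J0 JT JJ0; elim: k x => // k IH x.
by rewrite JkS JT; exact: le_bellman.
Qed.

End value_iteration.

Lemma value_iteration_cvg Jk :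
  (forall x, opt_proper_cost S x = bellman S (opt_proper_cost S) x) ->
  What S (Jk 0%N) -> (forall k x, Jk k.+1 x = bellman S (Jk k) x) ->
  forall x, (fun k => Jk k x) @ \oo --> opt_proper_cost S x.
Proof.
move=> hatT [[Jk0 _] hatJ0 J0lim] JkS x.
have lo k : opt_proper_cost S x <= Jk k x.
  by apply: value_iteration_ge => //; exact: opt_proper_cost_ge0.

apply: limn_esup_le_cvg lo; apply/ereal_infP => _ [pi properP <-].
have [Ppi _ _] := properP.
have ub_cvg : (fun k => partial_cost S k pi x + expect_state S pi x k (Jk 0%N))
    @ \oo --> policy_cost S pi x.
  rewrite -[X in _ --> X]adde0; apply: cvgeD; last exact: J0lim.
    by rewrite fin_num_adde_defl.
  exact: partial_cost_cvg.
rewrite -(cvg_limn_einf_sup ub_cvg).2; apply: le_limn_esup => k.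
exact: value_iteration_le.
Qed.

(** * Stationary policies *)
Section stationary_policies.
Context (mu : X -> U).
Context (Pmu : policy S (stationary mu)).

Lemma partial_cost_le_superharmonic J n x : (forall y, 0 <= J y) ->
  (forall y, qfactor S J y (mu y) <= J y) ->
  partial_cost S n (stationary mu) x <= J x.
Proof.
move=> J0 Jmu.
have := partial_cost_near_greedy hS (e := fun=> 0%R) n x Pmu J0
  (fun=> lexx _).
by rewrite big1// adde0; apply => k y; rewrite adde0; exact: Jmu.
Qed.

(** The hypothesis that ties the two optimal costs matters at the states where
no policy is proper: there the stationary policy must have infinite cost, and
opt_cost is the lower bound that shows it. *)
Lemma argmin_optimal_proper x :
  (forall y, opt_proper_cost S y = bellman S (opt_proper_cost S) y) ->
  (opt_cost S x < +oo -> opt_proper_cost S x < +oo) ->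
  (opt_proper_cost S x < +oo -> proper_policy S x (stationary mu)) ->
  (forall y, bellman_argmin S (opt_proper_cost S) y (mu y)) ->
  policy_cost S (stationary mu) x = opt_proper_cost S x.
Proof.
move=> hatT finx propmu argmu; apply/eqP; rewrite eq_le; apply/andP; split.
  apply: (policy_cost_le hS) => // n; apply: partial_cost_le_superharmonic => y.
    exact: opt_proper_cost_ge0.
  by have [_ ->] := argmu y; rewrite -hatT.
have [fin|] := ltP (opt_proper_cost S x) +oo.
  by apply: ereal_inf_lbound; exists (stationary mu); [exact: propmu|by []].
rewrite leye_eq => /eqP hatx; rewrite hatx leye_eq eq_le leey/= leNgt.
apply/negP => Jfin; have : opt_proper_cost S x < +oo.
  by apply: finx; apply: le_lt_trans Jfin; exact: opt_cost_le.
by rewrite hatx ltxx.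
Qed.

Lemma optimal_proper_argmin x :
  (forall y, opt_proper_cost S y = bellman S (opt_proper_cost S) y) ->
  (forall y, policy_cost S (stationary mu) y = opt_proper_cost S y) ->
  bellman_argmin S (opt_proper_cost S) x (mu x).
Proof.
move=> hatT optmu; split; first exact: (Pmu 0%N).
rewrite -hatT -optmu (policy_cost_qfactor hS x Pmu); congr qfactor.
by apply/funext => y; rewrite -optmu.
Qed.

End stationary_policies.

End proper_policies.

Theorem proposition5 (R : realType) (X U : Type) (d : measure_display)
    (W : measurableType d) (S : ssp_data R X U W)
    (hS : stochastic_shortest_path S)
    (hQ : exists delta : R, (0 < delta)%R /\
      forall (x : X) (u : U), opt_cost S x < +oo -> controls S x u ->
        perturbed_qfactor S delta x u < +oo) :
  (* (a) *)
  ((What S (opt_proper_cost S) /\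
    (forall x : X, opt_proper_cost S x = bellman S (opt_proper_cost S) x)) /\
   (forall J : X -> \bar R, What S J -> (forall x : X, J x = bellman S J x) ->
      forall x : X, J x = opt_proper_cost S x)) /\
  (* (b) *)
  (forall Jk : nat -> X -> \bar R, What S (Jk 0%N) ->
     (forall (k : nat) (x : X), Jk k.+1 x = bellman S (Jk k) x) ->
     forall x : X, (fun k : nat => Jk k x) @ \oo --> opt_proper_cost S x) /\
  (* (c) *)
  (forall mu : X -> U, policy S (stationary mu) ->
     (forall x : X, opt_proper_cost S x < +oo -> proper_policy S x (stationary mu)) ->
     ((forall x : X, bellman_argmin S (opt_proper_cost S) x (mu x)) ->
        forall x : X, policy_cost S (stationary mu) x = opt_proper_cost S x) /\
     ((forall x : X, policy_cost S (stationary mu) x = opt_proper_cost S x) ->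
        forall x : X, bellman_argmin S (opt_proper_cost S) x (mu x))).
Proof.
have [delta [delta0 Qfin]] := hQ.
have hatT := opt_proper_cost_bellman hS delta0 Qfin.
have VI Jk := @value_iteration_cvg _ _ _ _ _ _ hS Jk hatT.
split; [split; first by split; [exact: opt_proper_cost_What|]|split=> //].
- move=> J WJ JT x.
  have := VI (fun=> J) WJ (fun _ => JT) x.
  by move=> /(cvg_lim (@ereal_hausdorff R)); rewrite lim_cst.
- move=> mu Pmu propmu; split=> [argmu x|optmu x].
    apply: (argmin_optimal_proper hS Pmu hatT _ (propmu x) argmu).
    exact: (opt_proper_cost_lty hS delta0 Qfin).
  exact: optimal_proper_argmin.
Qed.
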